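(* If $\gamma>2\pi/5$ (with $\gamma\in(0,\pi)$), then $\mathbf S_\gamma(\varphi_2)$ covers the full circle $\mathcal C(\mathbf s_0,\mathbf s_4)$ when $\varphi_2$ varies in $[0,2\pi)$.
   Context: Let $\mathbf s_0=\mathbf u_i$ and $\mathbf s_4=\mathbf u_f$ be unit vectors in $\mathbb R^3$ with $\mathbf u_i\times\mathbf u_f\neq\mathbf 0$, and let $\gamma=\arccos(\mathbf u_i\cdot\mathbf u_f)\in(0,\pi)$. Put $$\mathbf b=\frac{\mathbf s_0+\mathbf s_4}{|\mathbf s_0+\mathbf s_4|},\qquad \mathbf n=-\frac{\mathbf s_0\times\mathbf s_4}{|\mathbf s_0\times\mathbf s_4|}.$$ $\mathcal C(\mathbf s_0,\mathbf s_4)=\{\mathbf x\in\mathbb S^2:\mathbf x\cdot\mathbf s_0=\mathbf x\cdot\mathbf s_4\}$ is the great circle of points equidistant from $\mathbf s_0$ and $\mathbf s_4$, i.e. the unit circle of the plane spanned by $\mathbf b,\mathbf n$. For $\varphi_2\in\mathbb R$ define $$\mathbf q_1=\mathbf u_i+\mathbf u_f=\sqrt{2(1+\cos\gamma)}\,\mathbf b,\qquad \mathbf q_2(\varphi_2)=\cos\varphi_2\,\mathbf b+\sin\varphi_2\,\sin\tfrac\gamma2\,\mathbf n,$$ $$\mathbf s_2=\frac{\mathbf q_2}{|\mathbf q_2|},\qquad \mathbf s_{02}=\frac{\mathbf q_1+2\mathbf q_2}{2(1+\cos\varphi_2\cos\frac\gamma2)},\qquad \mathbf q_3(\varphi_2)=\sqrt{|\mathbf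 q_2|}\,\sqrt{2\left(1+\cos\varphi_2\cos\tfrac\gamma2\right)}\;\frac{\mathbf s_{02}+\mathbf s_2}{|\mathbf s_{02}+\mathbf s_2|}$$ ($\mathbf s_{02}$ is a unit vector and $\mathbf s_{02}+\mathbf s_2$ never vanishes). The scaled PH displacement is $\mathbf I_\gamma(\varphi_2)=\mathbf q_1+\mathbf q_2(\varphi_2)+\mathbf q_3(\varphi_2)$, and the unit PH displacement is $\mathbf S_\gamma(\varphi_2)=\mathbf I_\gamma(\varphi_2)/|\mathbf I_\gamma(\varphi_2)|\in\mathcal C(\mathbf s_0,\mathbf s_4)$, defined whenever $\mathbf I_\gamma(\varphi_2)\ne\mathbf 0$. *)

(* Defs.v *)
From HB Require Import structures.
From mathcomp Require Import all_boot all_order all_algebra.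
From mathcomp Require Import all_classical all_reals all_analysis.

Set Implicit Arguments.
Unset Strict Implicit.
Unset Printing Implicit Defensive.

Import Order.TTheory GRing.Theory Num.Theory.
Local Open Scope classical_set_scope.
Local Open Scope ring_scope.

Section EuclideanSpace3.
Variable R : realType.
Implicit Types u v : 'rV[R]_3.

Definition dot u v : R := \sum_(i < 3) u 0 i * v 0 i.

(* The library norm `|u| on row vectors is the sup norm, hence this one. *)
Definition enorm u : R := Num.sqrt (dot u u).

(* The zero vector is sent to itself. *)
Definition normalize u : 'rV[R]_3 := (enorm u)^-1 *: u.

Definition cross u v : 'rV[R]_3 :=
  let x (w : 'rV[R]_3) (k : nat) : R := w 0 (inord k) in
  \row_(k < 3) [:: x u 1%N * x v 2%N - x u 2%N * x v 1%N;
                   x u 2%N * x v 0%N - x u 0%N * x v 2%N;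
                   x u 0%N * x v 1%N - x u 1%N * x v 0%N]`_k.

End EuclideanSpace3.

Section PHDisplacement.
Variables (R : realType) (ui uf : 'rV[R]_3).

Definition angle : R := acos (dot ui uf).

Definition bvec : 'rV[R]_3 := normalize (ui + uf).

Definition nvec : 'rV[R]_3 := - normalize (cross ui uf).

Definition equidistant_circle : set 'rV[R]_3 :=
  [set x | enorm x = 1 /\ dot x ui = dot x uf].

Definition q1 : 'rV[R]_3 := ui + uf.

Definition q2 (phi : R) : 'rV[R]_3 :=
  cos phi *: bvec + (sin phi * sin (angle / 2)) *: nvec.

Definition s2 (phi : R) : 'rV[R]_3 := normalize (q2 phi).

Definition s02 (phi : R) : 'rV[R]_3 :=
  (2 * (1 + cos phi * cos (angle / 2)))^-1 *: (q1 + 2 *: q2 phi).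

Definition q3 (phi : R) : 'rV[R]_3 :=
  (Num.sqrt (enorm (q2 phi)) *
   Num.sqrt (2 * (1 + cos phi * cos (angle / 2)))) *:
  normalize (s02 phi + s2 phi).

Definition scaled_displacement (phi : R) : 'rV[R]_3 := q1 + q2 phi + q3 phi.

(* Meaningful only at the phi where scaled_displacement phi is nonzero;
   elsewhere its value is the junk value 0. *)
Definition unit_displacement (phi : R) : 'rV[R]_3 :=
  normalize (scaled_displacement phi).

End PHDisplacement.

(* Main.v *)
Require Import Defs.
From HB Require Import structures.
From mathcomp Require Import all_boot all_order all_algebra.
From mathcomp Require Import all_classical all_reals all_analysis.
From mathcomp Require Import ring lra.

Set Implicit Arguments.
Unset Strict Implicit.
Unset Printing Implicit Defensive.

Import Order.TTheory GRing.Theory Num.Theory.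
Import numFieldNormedType.Exports.
Local Open Scope classical_set_scope.
Local Open Scope ring_scope.

(** Write [c = cos (gamma/2)] and [s = sin (gamma/2)].  The frame [b], [n] is
    orthonormal and the equidistant circle is the unit circle of its plane, so
    the scaled displacement is a planar curve [disp_b phi *: b + disp_n phi *: n]
    ([scaled_displacementE], [equidistant_circleP]).

    The component [disp_n phi] is a positive multiple of [sin phi]
    ([disp_nE]): the [n]-components of [q2], [s02] and [s2] all are, and [q1] has
    none.  Hence on [0, pi] the curve stays in the closed upper half plane and
    meets the axis of [b] only at the ends.  At [phi = 0] it points along [b]; at
    [phi = pi] its abscissa is [2 c - 1 - sqrt (2 (1 - c))], which is negative
    exactly when [4 c^2 - 2 c - 1 < 0], that is when [c < cos (pi/5)], that is
    when [gamma > 2 pi / 5] ([disp_b_pi], [cos_pi5]).  So on [0, pi] the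
    direction of the curve goes from [b] to [-b] through the upper half plane,
    and by the intermediate value theorem it takes every direction of the upper
    half circle ([disp_upper]).  The reflection [phi |-> 2 pi - phi] fixes
    [disp_b] and negates [disp_n], which gives the lower half circle
    ([disp_direction]). *)

(** * Dot and cross products in dimension three *)

Section EuclideanGeometry.
Variable R : realType.
Implicit Types (u v w e : 'rV[R]_3) (x y k : R).

Lemma dotC u v : dot u v = dot v u.
Proof. by apply: eq_bigr => i _; rewrite mulrC. Qed.

Lemma dotDl u v w : dot (u + v) w = dot u w + dot v w.
Proof. by rewrite -big_split; apply: eq_bigr => i _; rewrite mxE mulrDl. Qed.

Lemma dotZl k u w : dot (k *: u) w = k * dot u w.
Proof. by rewrite mulr_sumr; apply: eq_bigr => i _; rewrite mxE mulrA. Qed.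

Lemma dot_comb x u y v w : dot (x *: u + y *: v) w = x * dot u w + y * dot v w.
Proof. by rewrite dotDl !dotZl. Qed.

Lemma dotNl u w : dot (- u) w = - dot u w.
Proof. by rewrite -scaleN1r dotZl mulN1r. Qed.

Lemma dotBl u v w : dot (u - v) w = dot u w - dot v w.
Proof. by rewrite dotDl dotNl. Qed.

Lemma dotDr u v w : dot w (u + v) = dot w u + dot w v.
Proof. by rewrite dotC dotDl !(dotC w). Qed.

Lemma dotZr k u w : dot w (k *: u) = k * dot w u.
Proof. by rewrite dotC dotZl dotC. Qed.

Lemma dotNr u w : dot w (- u) = - dot w u.
Proof. by rewrite dotC dotNl dotC. Qed.

Lemma dotuu_ge0 u : 0 <= dot u u.
Proof. by apply: sumr_ge0 => i _; rewrite -expr2 sqr_ge0. Qed.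

Lemma dotuu_eq0 u : dot u u = 0 -> u = 0.
Proof.
move=> u0; apply/rowP => i; rewrite mxE; apply/eqP.
rewrite -sqrf_eq0 expr2; apply/eqP.
by apply: (psumr_eq0P _ u0) => // j _; rewrite -expr2 sqr_ge0.
Qed.

Lemma dotuu_gt0 u : u != 0 -> 0 < dot u u.
Proof.
move=> u0; rewrite lt_neqAle dotuu_ge0 andbT eq_sym.
by apply: contraNneq u0 => /dotuu_eq0 ->.
Qed.

Lemma enorm_sqr u : enorm u ^+ 2 = dot u u.
Proof. by rewrite sqr_sqrtr ?dotuu_ge0. Qed.

Lemma enorm_gt0 u : u != 0 -> 0 < enorm u.
Proof. by move=> u0; rewrite sqrtr_gt0 dotuu_gt0. Qed.

Lemma dot_normalize u : u != 0 -> dot (normalize u) (normalize u) = 1.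
Proof.
move=> u0; have := enorm_gt0 u0; rewrite /normalize dotZl dotZr -enorm_sqr.
by move=> ?; field; rewrite gt_eqF.
Qed.

Lemma scale_normalize u : u != 0 -> enorm u *: normalize u = u.
Proof.
by move=> u0; rewrite /normalize scalerA mulfV ?scale1r// gt_eqF ?enorm_gt0.
Qed.

Lemma dot_coordE u v : dot u v =
  u 0 (inord 0) * v 0 (inord 0) + u 0 (inord 1) * v 0 (inord 1)
  + u 0 (inord 2) * v 0 (inord 2).
Proof.
rewrite /dot !big_ord_recl big_ord0 addr0 addrA.
by do ![congr (_ + _)]; congr (_ * _); congr (_ _ _);
  apply/val_inj; rewrite /= inordK.
Qed.

Lemma cross_coordE u v :
  (cross u v 0 (inord 0) =
     u 0 (inord 1) * v 0 (inord 2) - u 0 (inord 2) * v 0 (inord 1)) *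
  (cross u v 0 (inord 1) =
     u 0 (inord 2) * v 0 (inord 0) - u 0 (inord 0) * v 0 (inord 2)) *
  (cross u v 0 (inord 2) =
     u 0 (inord 0) * v 0 (inord 1) - u 0 (inord 1) * v 0 (inord 0)).
Proof. by split; [split|]; rewrite mxE inordK. Qed.

Lemma dot_crossl u v : dot u (cross u v) = 0.
Proof. by rewrite dot_coordE !cross_coordE; ring. Qed.

Lemma dot_crossr u v : dot v (cross u v) = 0.
Proof. by rewrite dot_coordE !cross_coordE; ring. Qed.

Lemma lagrange_identity u v :
  dot (cross u v) (cross u v) = dot u u * dot v v - dot u v ^+ 2.
Proof. by rewrite !dot_coordE !cross_coordE; ring. Qed.

(** The square of the triple product of [e], [u], [v] is their Gram determinant;
    here its expansion is solved for the product of squared lengths of [e] and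
    [cross u v]. *)
Lemma gram_identity e u v :
  dot e e * dot (cross u v) (cross u v) =
  dot e (cross u v) ^+ 2 + dot e v ^+ 2 * dot u u
  - 2 * dot e u * dot e v * dot u v + dot e u ^+ 2 * dot v v.
Proof. by rewrite !dot_coordE !cross_coordE; ring. Qed.

(** When [cross u v] is nonzero, the vectors [u], [v], [cross u v] span the space. *)
Lemma orthogonal_cross_eq0 e u v : cross u v != 0 ->
  dot e u = 0 -> dot e v = 0 -> dot e (cross u v) = 0 -> e = 0.
Proof.
move=> uv0 eu ev ew; apply: dotuu_eq0; apply/eqP.
have /eqP := gram_identity e u v.
rewrite eu ev ew !(mulr0, mul0r, expr0n, subr0, addr0).
by rewrite mulf_eq0 (gt_eqF (dotuu_gt0 uv0)) orbF.
Qed.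

Lemma enorm_frame b n x y : dot b b = 1 -> dot n n = 1 -> dot b n = 0 ->
  enorm (x *: b + y *: n) = Num.sqrt (x ^+ 2 + y ^+ 2).
Proof.
move=> bb nn bn; rewrite /enorm; congr Num.sqrt.
by rewrite !(dotDl, dotDr, dotZl, dotZr) bb nn (dotC n) bn; ring.
Qed.

End EuclideanGeometry.

(** * The planar displacement curve *)

Section PlanarDisplacement.
Variables (R : realType) (c s : R).
Hypotheses (c_gt0 : 0 < c) (s_gt0 : 0 < s) (cs1 : c ^+ 2 + s ^+ 2 = 1).
Implicit Types phi x y : R.

Definition q2_norm phi := Num.sqrt (cos phi ^+ 2 + (sin phi * s) ^+ 2).

(** Coordinates in the frame [b], [n] of [s02 + s2], the vector that gives [q3]
    its direction; the common factor 2 in [s02] is cancelled. *)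
Definition bisector_b phi :=
  (1 + cos phi * c)^-1 * (c + cos phi) + (q2_norm phi)^-1 * cos phi.

Definition bisector_n phi :=
  ((1 + cos phi * c)^-1 + (q2_norm phi)^-1) * (sin phi * s).

Definition bisector_norm phi :=
  Num.sqrt (bisector_b phi ^+ 2 + bisector_n phi ^+ 2).

Definition q3_scale phi :=
  Num.sqrt (q2_norm phi) * Num.sqrt (2 * (1 + cos phi * c))
  / bisector_norm phi.

Definition disp_b phi := 2 * c + cos phi + q3_scale phi * bisector_b phi.

Definition disp_n phi := sin phi * s + q3_scale phi * bisector_n phi.

Lemma c_lt1 : c < 1.
Proof. by have := s_gt0; have := c_gt0; have := cs1; nra. Qed.

Lemma denom_gt0 phi : 0 < 1 + cos phi * c.
Proof.
have := cos_geN1 phi; have := cos_le1 phi; have := c_lt1; have := c_gt0; nra.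
Qed.

Lemma q2_norm_gt0 phi : 0 < q2_norm phi.
Proof.
rewrite sqrtr_gt0; have /eqP := cos2Dsin2 phi; rewrite eq_sym => /eqP h.
rewrite lt_neqAle eq_sym addr_ge0 ?sqr_ge0// andbT paddr_eq0 ?sqr_ge0//.
rewrite !sqrf_eq0 mulf_eq0 (gt_eqF s_gt0) orbF.
apply/andP => -[/eqP c0 /eqP s0]; move: h.
by rewrite c0 s0 expr0n addr0 => /eqP; rewrite oner_eq0.
Qed.

Lemma bisector_n_factor_gt0 phi : 0 < (1 + cos phi * c)^-1 + (q2_norm phi)^-1.
Proof. by rewrite addr_gt0// invr_gt0 ?denom_gt0 ?q2_norm_gt0. Qed.

Lemma q2_norm_axis phi : sin phi = 0 -> q2_norm phi = 1.
Proof.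
move=> s0; have := cos2Dsin2 phi.
by rewrite /q2_norm s0 mul0r expr0n => ->; rewrite sqrtr1.
Qed.

(** Where [sin phi = 0], both [s02] and [s2] equal [cos phi *: b], so they add up
    instead of cancelling. *)
Lemma bisector_b_axis phi : sin phi = 0 -> bisector_b phi = 2 * cos phi.
Proof.
move=> s0; rewrite /bisector_b q2_norm_axis// invr1 mul1r.
have := cos2Dsin2 phi; rewrite s0 expr0n addr0 => c2.
have -> : c + cos phi = (1 + cos phi * c) * cos phi.
  by rewrite mulrDl mul1r mulrAC -expr2 c2 mul1r addrC.
by rewrite mulrA mulVf ?gt_eqF ?denom_gt0// mul1r mulr2n mulrDl mul1r.
Qed.

(** [s02] and [s2] are never opposite: off the axis their [n]-components have
    the same sign, and on the axis they coincide.  This makes [q3] continuous. *)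
Lemma bisector_norm_gt0 phi : 0 < bisector_norm phi.
Proof.
rewrite sqrtr_gt0 lt_neqAle eq_sym addr_ge0 ?sqr_ge0// andbT.
rewrite paddr_eq0 ?sqr_ge0// !sqrf_eq0; apply/andP => -[b0].
rewrite /bisector_n !mulf_eq0 (gt_eqF (bisector_n_factor_gt0 phi)).
rewrite (gt_eqF s_gt0) orbF /= => /eqP s0.
move: b0; rewrite bisector_b_axis// mulf_eq0 pnatr_eq0 /= => /eqP c0.
have := cos2Dsin2 phi; rewrite c0 s0 !expr0n addr0 => /eqP.
by rewrite eq_sym oner_eq0.
Qed.

Lemma q3_scale_gt0 phi : 0 < q3_scale phi.
Proof.
rewrite divr_gt0 ?bisector_norm_gt0// mulr_gt0// sqrtr_gt0 ?q2_norm_gt0//.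
by rewrite mulr_gt0 ?denom_gt0.
Qed.

(** The sign of [disp_n] is that of [sin phi], which confines each half of the
    curve to one half plane. *)
Lemma disp_nE phi : exists2 k, 0 < k & disp_n phi = k * sin phi.
Proof.
exists (s + q3_scale phi * ((1 + cos phi * c)^-1 + (q2_norm phi)^-1) * s).
  by apply: addr_gt0 => //; do 2!apply: mulr_gt0 => //;
    [exact: q3_scale_gt0 | exact: bisector_n_factor_gt0].
by rewrite /disp_n /bisector_n; ring.
Qed.

Lemma disp_n_gt0 phi : 0 < phi < pi -> 0 < disp_n phi.
Proof.
by move=> /sin_gt0_pi ?; have [k k0 ->] := disp_nE phi; rewrite mulr_gt0. Qed.

Lemma disp_n_axis phi : sin phi = 0 -> disp_n phi = 0.
Proof. by move=> s0; have [k _ ->] := disp_nE phi; rewrite s0 mulr0. Qed.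

Lemma disp_b_0 : 0 < disp_b 0.
Proof.
rewrite /disp_b bisector_b_axis ?sin0// cos0 mulr1.
by apply: addr_gt0; [apply: addr_gt0 => //|]; apply: mulr_gt0 => //;
  exact: q3_scale_gt0.
Qed.

Lemma disp_b_pi : disp_b pi = 2 * c - 1 - Num.sqrt (2 * (1 - c)).
Proof.
rewrite /disp_b /q3_scale /bisector_norm /bisector_n bisector_b_axis ?sinpi//.
rewrite q2_norm_axis ?sinpi// cospi mul0r mulr0 expr0n addr0 sqrtr1 mulN1r.
by rewrite sqrtr_sqr mulrN1 normrN ger0_norm//; field.
Qed.

(** For [2 c > 1] squaring turns the claim into the hypothesis. *)
Lemma disp_b_pi_lt0 : 4 * c ^+ 2 - 2 * c - 1 < 0 -> disp_b pi < 0.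
Proof.
move=> h; rewrite disp_b_pi subr_lt0.
have c1 := c_lt1; have c0 := c_gt0.
have [le0|gt0] := leP (2 * c - 1) 0.
  by apply: le_lt_trans le0 _; rewrite sqrtr_gt0; lra.
rewrite -(ger0_norm (ltW gt0)) -sqrtr_sqr ltr_sqrt; first nra.
by lra.
Qed.

Lemma disp_reflect phi :
  (disp_b (2 * pi - phi) = disp_b phi) * (disp_n (2 * pi - phi) = - disp_n phi).
Proof.
have C : cos (2 * pi - phi) = cos phi.
  by rewrite mulrC mulr_natr addrC cosD2pi cosN.
have S : sin (2 * pi - phi) = - sin phi.
  by rewrite mulrC mulr_natr addrC sinD2pi sinN.
rewrite /disp_b /disp_n /q3_scale /bisector_norm /bisector_n /bisector_b.
by rewrite /q2_norm C S !mulNr !mulrN !sqrrN opprD.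
Qed.

(* In the continuity proofs, the leaves are closed by assumption from these
   section facts. *)
Let sqrt_cont (f : R -> R) : continuous f -> continuous (fun x => Num.sqrt (f x)).
Proof. by move=> cf x; apply: continuous_comp (cf x) _; exact: sqrt_continuous. Qed.

Let D_cont (f g : R -> R) : continuous f -> continuous g ->
  continuous (fun x => f x + g x).
Proof. by move=> cf cg x; exact: continuousD (cf x) (cg x). Qed.

Let M_cont (f g : R -> R) : continuous f -> continuous g ->
  continuous (fun x => f x * g x).
Proof. by move=> cf cg x; exact: continuousM (cf x) (cg x). Qed.

Let V_cont (f : R -> R) : (forall x, f x != 0) -> continuous f ->
  continuous (fun x => (f x)^-1).
Proof. by move=> f0 cf x; exact: continuousV (f0 x) (cf x). Qed.

Let cst_cont (k : R) : continuous (fun _ : R => k).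
Proof. by move=> x; exact: cvg_cst. Qed.

Let X2_cont (f : R -> R) : continuous f -> continuous (fun x => f x ^+ 2).
Proof. by move=> cf; exact: M_cont. Qed.

Let cosc := @continuous_cos R.
Let sinc := @continuous_sin R.

Let r_cont : continuous q2_norm.
Proof. by apply/sqrt_cont/D_cont; apply: X2_cont => //; exact: M_cont. Qed.

Let d_cont : continuous (fun phi => 1 + cos phi * c).
Proof. by apply: D_cont => //; exact: M_cont. Qed.

Let dV_cont : continuous (fun phi => (1 + cos phi * c)^-1).
Proof. by apply: V_cont => // phi; rewrite gt_eqF ?denom_gt0. Qed.

Let rV_cont : continuous (fun phi => (q2_norm phi)^-1).
Proof. by apply: V_cont => // phi; rewrite gt_eqF ?q2_norm_gt0. Qed.

Let bb_cont : continuous bisector_b.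
Proof. by apply: D_cont; apply: M_cont => //; exact: D_cont. Qed.

Let bn_cont : continuous bisector_n.
Proof. by apply: M_cont; [exact: D_cont | exact: M_cont]. Qed.

Let k_cont : continuous q3_scale.
Proof.
apply: M_cont; first by apply: M_cont; apply: sqrt_cont => //; exact: M_cont.
apply: V_cont => [phi|]; first by rewrite gt_eqF ?bisector_norm_gt0.
by apply/sqrt_cont/D_cont; exact: X2_cont.
Qed.

Lemma disp_b_continuous : continuous disp_b.
Proof. by apply: D_cont; [exact: D_cont | exact: M_cont]. Qed.

Lemma disp_n_continuous : continuous disp_n.
Proof. by apply: D_cont; exact: M_cont. Qed.

(** The function below vanishes when the curve is parallel to [(x, y)]; it is
    positive at 0 and negative at [pi].  As [disp_n phi] and [y] are both
    positive, parallel then means in the same direction. *)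
Lemma disp_upper x y : disp_b pi < 0 -> 0 < y ->
  exists phi, [/\ 0 < phi < pi, 0 < disp_n phi
                & disp_b phi * y = disp_n phi * x].
Proof.
move=> bpi y0; pose f phi := disp_b phi * y + disp_n phi * - x.
have pi0 := pi_gt0 R.
have cf : continuous f.
  by apply: D_cont; apply: M_cont => //;
    [exact: disp_b_continuous | exact: disp_n_continuous].
have f0 : 0 < f 0.
  by rewrite /f (disp_n_axis (sin0 R)) mul0r addr0 mulr_gt0 ?disp_b_0.
have fpi : f pi < 0.
  by rewrite /f (disp_n_axis (sinpi R)) mul0r addr0 nmulr_rlt0.
have [||phi] := @IVT R f 0 pi 0 (ltW pi0).
- exact: continuous_subspaceT.
- by rewrite ge_min le_max (ltW f0) (ltW fpi) orbT.
rewrite in_itv /= => /andP[p0 pp] fphi.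
have phi_in : 0 < phi < pi.
  rewrite !lt_neqAle p0 pp !andbT; apply/andP; split.
    by apply: contraTneq f0 => e; rewrite -e in fphi; rewrite fphi ltxx.
  by apply: contraTneq fpi => e; rewrite e in fphi; rewrite fphi ltxx.
exists phi; split => //; first exact: disp_n_gt0.
by apply/eqP; rewrite -subr_eq0 -mulrN -[X in X == _]/(f phi) fphi.
Qed.

Lemma disp_direction x y : disp_b pi < 0 -> x ^+ 2 + y ^+ 2 = 1 ->
  exists phi k, [/\ 0 <= phi < 2 * pi, 0 < k, disp_b phi = k * x
                  & disp_n phi = k * y].
Proof.
move=> bpi xy1; have pi0 := pi_gt0 R.
have upper x' y' : 0 < y' -> exists phi k, [/\ 0 < phi < pi, 0 < k,
    disp_b phi = k * x' & disp_n phi = k * y'].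
  move=> y0; have [phi [phi_in n0 par]] := disp_upper x' bpi y0.
  exists phi, (disp_n phi / y'); split => //.
  - by rewrite divr_gt0.
  - by rewrite mulrAC -par mulfK ?gt_eqF.
  - by rewrite divfK ?gt_eqF.
have [y_lt0|y_gt0|y0] := ltgtP y 0.
- (* Mirror image of a point of the upper half circle. *)
  have [|phi [k [/andP[p0 pp] k0 bE nE]]] := upper x (- y).
    by rewrite oppr_gt0.
  exists (2 * pi - phi), k; rewrite !disp_reflect bE nE mulrN opprK.
  by split=> //; apply/andP; split; lra.
- have [phi [k [/andP[p0 pp] k0 bE nE]]] := upper x y y_gt0.
  by exists phi, k; split=> //; apply/andP; split; lra.
move: xy1; rewrite y0 expr0n addr0 => /eqP.
rewrite sqrf_eq1 => /orP[] /eqP ->.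
- exists 0, (disp_b 0); rewrite disp_b_0 mulr1 mulr0 disp_n_axis ?sin0//.
  by split=> //; rewrite lexx mulr_gt0.
- exists pi, (- disp_b pi); rewrite mulrN1 opprK mulr0 disp_n_axis ?sinpi//.
  by split=> //; [apply/andP; split; lra | rewrite oppr_gt0].
Qed.

End PlanarDisplacement.

(** * The threshold angle *)

Section Angles.
Variable R : realType.
Implicit Type x : R.

(** Since [2 (pi/5)] and [3 (pi/5)] are supplementary, the double and triple
    angle formulas make [g] a root of [4 g^3 + 2 g^2 - 3 g - 1], which factors as
    [(g + 1) (4 g^2 - 2 g - 1)]. *)
Lemma cos_pi5 (g := cos (pi / 5) : R) : 0 < g /\ 4 * g ^+ 2 - 2 * g - 1 = 0.
Proof.
have pi0 := pi_gt0 R.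
have g0 : 0 < g by apply: cos_gt0_pihalf; apply/andP; split; lra.
split=> //.
have c2 : cos (2 * (pi / 5)) = 2 * g ^+ 2 - 1 :> R.
  by rewrite (_ : 2 * (pi / 5) = (pi / 5) *+ 2) ?cos_mulr2n -/g;
    [rewrite -mulr_natl; ring | field].
have c3 : cos (3 * (pi / 5)) = 4 * g ^+ 3 - 3 * g :> R.
  rewrite (_ : 3 * (pi / 5) = (pi / 5) *+ 2 + pi / 5); last by field.
  rewrite cosD cos_mulr2n sin_mulr2n -/g.
  have := cos2Dsin2 (pi / 5 : R); rewrite -/g => /eqP.
  rewrite addrC eq_sym -subr_eq => /eqP e.
  transitivity ((g ^+ 2 *+ 2 - 1) * g - g * sin (pi / 5) ^+ 2 *+ 2); first by ring.
  by rewrite -e; ring.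
have : cos (2 * (pi / 5)) = - cos (3 * (pi / 5)) :> R.
  have -> : 2 * (pi / 5) = - (3 * (pi / 5) + pi) + pi *+ 2 :> R.
    by rewrite -(mulr_natl pi 2); field.
  by rewrite cosD2pi cosN cosDpi.
rewrite c2 c3 => h.
have /eqP : (g + 1) * (4 * g ^+ 2 - 2 * g - 1) = 0.
  have -> : (g + 1) * (4 * g ^+ 2 - 2 * g - 1) =
      2 * g ^+ 2 - 1 - - (4 * g ^+ 3 - 3 * g) by ring.
  by rewrite h subrr.
by rewrite mulf_eq0 gt_eqF ?addr_gt0//= => /eqP.
Qed.

(** [4 y^2 - 2 y - 1] vanishes at [y = cos (pi/5)] and is negative on the part of
    [0, cos (pi/5)] below that root. *)
Lemma cos_gt_pi5_bound x : pi / 5 < x <= pi / 2 ->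
  4 * cos x ^+ 2 - 2 * cos x - 1 < 0.
Proof.
move=> /andP[x5 x2]; have pi0 := pi_gt0 R; have [g0 gE] := cos_pi5.
have c0 : 0 <= cos x by apply: cos_ge0_pihalf; apply/andP; split; lra.
have cg : cos x < cos (pi / 5) :> R.
  by rewrite ltr_cos// in_itv /=; apply/andP; split; lra.
(* The root property reads [g * (4 * g - 2) = 1]. *)
have g2 : 0 < 4 * cos (pi / 5) - 2 :> R.
  by rewrite -(pmulr_rgt0 _ g0); lra.
have le_prod : 0 <= cos x * (cos (pi / 5) - cos x).
  by rewrite mulr_ge0// subr_ge0 ltW.
have : 0 < (cos (pi / 5) - cos x) * (4 * cos (pi / 5) - 2).
  by rewrite mulr_gt0// subr_gt0.
lra.
Qed.

End Angles.

(** * The frame of the bisecting plane *)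

Section Frame.
Variables (R : realType) (ui uf : 'rV[R]_3).
Hypotheses (ui_unit : enorm ui = 1) (uf_unit : enorm uf = 1).
Hypothesis (ui_uf : cross ui uf != 0).
Local Notation c := (cos (angle ui uf / 2)).
Local Notation s := (sin (angle ui uf / 2)).
Local Notation b := (bvec ui uf).
Local Notation n := (nvec ui uf).

Let uu : dot ui ui = 1. Proof. by rewrite -enorm_sqr ui_unit expr1n. Qed.
Let ff : dot uf uf = 1. Proof. by rewrite -enorm_sqr uf_unit expr1n. Qed.

Lemma dot_sqr_lt1 : dot ui uf ^+ 2 < 1.
Proof.
have := dotuu_gt0 ui_uf.
by rewrite lagrange_identity uu ff mulr1 subr_gt0.
Qed.

Lemma dot_between : -1 < dot ui uf < 1.
Proof. by have := dot_sqr_lt1; move=> h; apply/andP; split; nra. Qed.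

Lemma angle_half_bounds : 0 < angle ui uf / 2 < pi / 2.
Proof.
have /andP[lo hi] := dot_between.
have a0 : 0 < angle ui uf by apply: acos_gt0; rewrite hi ltW.
have api : angle ui uf < pi by apply: acos_ltpi; rewrite lo ltW.
by apply/andP; split; lra.
Qed.

Lemma cos_half_gt0 : 0 < c.
Proof.
have /andP[lo hi] := angle_half_bounds.
by apply: cos_gt0_pihalf; apply/andP; split; lra.
Qed.

Lemma sin_half_gt0 : 0 < s.
Proof. exact: sin_gt0_pihalf angle_half_bounds. Qed.

Lemma dot_half_angle : dot ui uf = 2 * c ^+ 2 - 1.
Proof.
have /andP[lo hi] := dot_between.
have <- : cos (angle ui uf) = dot ui uf by rewrite acosK// in_itv /= !ltW.
rewrite -[in LHS](@divfK _ 2 _ (angle ui uf))// mulr_natr cos_mulr2n.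
by rewrite mulr_natl.
Qed.

Lemma enorm_q1 : enorm (q1 ui uf) = 2 * c.
Proof.
have c0 := cos_half_gt0.
rewrite -[RHS]ger0_norm ?mulr_ge0 ?(ltW c0)// -sqrtr_sqr; congr Num.sqrt.
rewrite /q1 !(dotDl, dotDr) uu ff (dotC uf) dot_half_angle; ring.
Qed.

Lemma q1_neq0 : ui + uf != 0.
Proof.
apply: contraTneq cos_half_gt0 => e; have := enorm_q1.
rewrite /q1 e => /esym/eqP; rewrite /enorm -(scale0r (0 : 'rV[R]_3)) dotZl mul0r.
by rewrite sqrtr0 mulf_eq0 pnatr_eq0 /= => /eqP ->; rewrite ltxx.
Qed.

Lemma q1E : q1 ui uf = (2 * c) *: b.
Proof. by rewrite -enorm_q1 scale_normalize ?q1_neq0. Qed.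

Lemma bvec_unit : dot b b = 1. Proof. exact: dot_normalize q1_neq0. Qed.

Lemma nvec_unit : dot n n = 1.
Proof. by rewrite dotNl dotNr opprK; exact: dot_normalize. Qed.

Lemma dot_ui_nvec : dot ui n = 0.
Proof. by rewrite dotNr dotZr dot_crossl mulr0 oppr0. Qed.

Lemma dot_uf_nvec : dot uf n = 0.
Proof. by rewrite dotNr dotZr dot_crossr mulr0 oppr0. Qed.

Lemma bvec_nvec : dot b n = 0.
Proof. by rewrite dotZl dotDl dot_ui_nvec dot_uf_nvec addr0 mulr0. Qed.

Lemma bvec_equidistant : dot b ui = dot b uf.
Proof. by rewrite !dotZl !dotDl uu ff (dotC uf ui) (addrC 1). Qed.

(** For [x] on the circle, its difference [e] with its projection on the plane of
    [b] and [n] is orthogonal to [n], to [b] and to [ui - uf], hence to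
    [cross ui uf], [ui] and [uf], so it is zero. *)
Lemma equidistant_circleP x : equidistant_circle ui uf x <->
  exists y z, y ^+ 2 + z ^+ 2 = 1 /\ x = y *: b + z *: n.
Proof.
split=> [[x1 xE]|[y [z [yz ->]]]]; last first.
  split; first by rewrite (enorm_frame _ _ bvec_unit nvec_unit bvec_nvec) yz sqrtr1.
  rewrite !dot_comb bvec_equidistant.
  by rewrite !(dotC n) dot_ui_nvec dot_uf_nvec.
pose e := x - (dot x b *: b + dot x n *: n).
have eb : dot e b = 0.
  rewrite dotBl dot_comb bvec_unit (dotC n) bvec_nvec; ring.
have en : dot e n = 0.
  rewrite dotBl dot_comb nvec_unit bvec_nvec; ring.
have euf : dot e ui = dot e uf.
  rewrite !dotBl !dot_comb xE bvec_equidistant.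
  by rewrite !(dotC n) dot_ui_nvec dot_uf_nvec.
have eq : dot e ui + dot e uf = 0.
  by rewrite -dotDr -[ui + uf]/(q1 ui uf) q1E dotZr eb mulr0.
have eui : dot e ui = 0 by lra.
have ew : dot e (cross ui uf) = 0.
  by rewrite -(scale_normalize ui_uf) dotZr -[normalize _]opprK dotNr en oppr0 mulr0.
have e0 : e = 0 by apply: (orthogonal_cross_eq0 ui_uf); rewrite -?euf.
have xF : x = dot x b *: b + dot x n *: n by apply/eqP; rewrite -subr_eq0 -/e e0.
exists (dot x b), (dot x n); split=> //.
rewrite -[LHS]sqr_sqrtr ?addr_ge0 ?sqr_ge0//.
by rewrite -(enorm_frame _ _ bvec_unit nvec_unit bvec_nvec) -xF x1 expr1n.
Qed.

Lemma scaled_displacementE phi :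
  scaled_displacement ui uf phi = disp_b c s phi *: b + disp_n c s phi *: n.
Proof.
have D0 := denom_gt0 cos_half_gt0 sin_half_gt0 (cos2Dsin2 _) phi.
have bis : s02 ui uf phi + s2 ui uf phi =
    bisector_b c s phi *: b + bisector_n c s phi *: n.
  rewrite /s2 /normalize (enorm_frame _ _ bvec_unit nvec_unit bvec_nvec).
  rewrite /s02 q1E /q2 /bisector_b /bisector_n -/(q2_norm s phi).
  move: (q2_norm s phi)^-1 b n => r bv nv; apply/rowP => i; rewrite !mxE.
  by field; rewrite gt_eqF.
rewrite /scaled_displacement /q3 bis /normalize.
rewrite !(enorm_frame _ _ bvec_unit nvec_unit bvec_nvec) q1E.
rewrite -/(q2_norm s phi) -/(bisector_norm c s phi).
rewrite /disp_b /disp_n /q3_scale /q2; move: b n => bv nv.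
by apply/rowP => i; rewrite !mxE; ring.
Qed.

Lemma unit_displacement_on_circle phi : scaled_displacement ui uf phi != 0 ->
  equidistant_circle ui uf (unit_displacement ui uf phi).
Proof.
move=> I0; split.
  by rewrite /enorm dot_normalize// sqrtr1.
rewrite /unit_displacement /normalize scaled_displacementE.
rewrite (dotZl _ (_ + _) ui) (dotZl _ (_ + _) uf) !dot_comb bvec_equidistant.
by rewrite !(dotC n) dot_ui_nvec dot_uf_nvec.
Qed.

Lemma normalize_frame k y z : 0 < k -> y ^+ 2 + z ^+ 2 = 1 ->
  (k * y *: b + k * z *: n != 0) /\
  normalize (k * y *: b + k * z *: n) = y *: b + z *: n.
Proof.
move=> k0 yz.
have E : enorm (k * y *: b + k * z *: n) = k.
  rewrite (enorm_frame _ _ bvec_unit nvec_unit bvec_nvec).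
  by rewrite !exprMn -mulrDr yz mulr1 sqrtr_sqr ger0_norm ?ltW.
split.
  apply: contraTneq k0 => v0; rewrite -E v0 /enorm -(scale0r (0 : 'rV[R]_3)).
  by rewrite dotZl mul0r sqrtr0 ltxx.
by rewrite /normalize E -!scalerA -scalerDr scalerA mulVf ?scale1r ?gt_eqF.
Qed.

End Frame.

(** * Covering the circle *)

Theorem proposition4p4 (R : realType) (ui uf : 'rV[R]_3)
    (ui_unit : enorm ui = 1) (uf_unit : enorm uf = 1)
    (ui_uf : cross ui uf != 0)
    (gamma_gt : 2 * pi / 5 < angle ui uf) :
  unit_displacement ui uf @`
    [set phi : R | 0 <= phi < 2 * pi /\ scaled_displacement ui uf phi != 0]
  = equidistant_circle ui uf.
Proof.
apply/seteqP; split=> [_ [phi [_ I0] <-]|v].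
  exact: unit_displacement_on_circle.
move=> /(equidistant_circleP ui_unit uf_unit ui_uf) [x [y [xy ->]]].
have c0 := cos_half_gt0 ui_unit uf_unit ui_uf.
have s0 := sin_half_gt0 ui_unit uf_unit ui_uf.
have cs1 := cos2Dsin2 (angle ui uf / 2).
have /andP[_ half_lt] := angle_half_bounds ui_unit uf_unit ui_uf.
have bpi : disp_b (cos (angle ui uf / 2)) (sin (angle ui uf / 2)) pi < 0.
  apply: disp_b_pi_lt0 => //; apply: cos_gt_pi5_bound.
  by apply/andP; split; lra.
have [phi [k [phi_in k0 bE nE]]] := disp_direction c0 s0 cs1 bpi xy.
have [I0 IE] := normalize_frame ui_unit uf_unit ui_uf k0 xy.
have scE := scaled_displacementE ui_unit uf_unit ui_uf phi.
exists phi; first by rewrite /= scE bE nE; split.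
by rewrite /unit_displacement scE bE nE IE.
Qed.
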